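(* Let $f=(f_{ij})\in C_c^2(S^2;D_1)$. Then: (a) $\mathcal{L}f\equiv 0$ on $\mathbb{R}^2$ if and only if there exists a (differentiable) scalar function $\varphi$ on $\mathbb{R}^2$ such that $$\nabla\varphi=\left(u_1^2 f_{11}+u_2^2 f_{22},\; 2u_1^2 f_{12}\right).$$ (b) $\mathcal{T}f\equiv 0$ on $\mathbb{R}^2$ if and only if there exists a (differentiable) scalar function $\varphi$ on $\mathbb{R}^2$ such that $$\nabla\varphi=\left(u_2^2 f_{11}+u_1^2 f_{22},\; -2u_1^2 f_{12}\right).$$ (c) $\mathcal{M}f\equiv 0$ on $\mathbb{R}^2$ if and only if there exists a (differentiable) scalar function $\varphi$ on $\mathbb{R}^2$ such that $$\nabla\varphi=\left((u_1^2-u_2^2) f_{12},\; -u_1^2 (f_{11}-f_{22})\right).$$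
   Context: $D_1\subset\mathbb{R}^2$ is an open disc of radius $r_1>0$ centered at the origin. $C_c^2(S^2;D_1)$ is the space of symmetric $2$-tensor fields $f=(f_{ij})_{i,j=1,2}$, $f_{12}=f_{21}$, whose (real) components are twice continuously differentiable and compactly supported in $D_1$ (extended by zero to $\mathbb{R}^2$). For symmetric $2$-tensors, $\langle f,g\rangle=f_{11}g_{11}+2f_{12}g_{12}+f_{22}g_{22}$. For vectors $a,b\in\mathbb{R}^2$, $(a\odot b)_{ij}=\frac12(a_ib_j+a_jb_i)$, $a^2=a\odot a$, and $a^\perp=(-a_2,a_1)$. For a unit vector $a$ and a compactly supported function $h$, $\mathcal{X}_a h(x)=\int_0^\infty h(x+ta)\,dt$, $x\in\mathbb{R}^2$. Fix unit vectors $u=(u_1,u_2)$ and $v=(-u_1,u_2)$ that are linearly independent (so $u_1u_2\neq0$, i.e. $-1<u_1^2-u_2^2<1$). The longitudinal, transverse and mixed V-line transforms are the functions on $\mathbb{R}^2$ $$\mathcal{L}f=\mathcal{X}_u\langle f,u^2\rangle+\mathcal{X}_v\langle f,v^2\rangle,\quad \mathcal{T}f=\mathcal{X}_u\langle f,(u^\perp)^2\rangle+\mathcal{X}_v\langle f,(v^\perp)^2\rangle,\quad \mathcal{M}f=\mathcal{X}_u\langle f,u\odot u^\perp\rangle+\mathcal{X}_v\langle f,v\odot v^\perp\rangle.$$ *)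

(* Defs.v *)
From Stdlib Require Import Reals List.
From Coquelicot Require Import Coquelicot.
Open Scope R_scope.

Definition vec : Type := (R * R)%type.

Definition vadd (a b : vec) : vec := (fst a + fst b, snd a + snd b).
Definition vscal (t : R) (a : vec) : vec := (t * fst a, t * snd a).

Definition unit_vec (a : vec) : Prop := fst a ^ 2 + snd a ^ 2 = 1.

Definition lin_indep (a b : vec) : Prop :=
  forall s t : R, vadd (vscal s a) (vscal t b) = (0, 0) -> s = 0 /\ t = 0.

Definition perp (a : vec) : vec := (- snd a, fst a).

(* A symmetric 2-tensor; the component of index 21 is c12. *)
Record sym2 : Type := Sym2 { c11 : R; c12 : R; c22 : R }.

Definition inner (f g : sym2) : R :=
  c11 f * c11 g + 2 * (c12 f * c12 g) + c22 f * c22 g.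

Definition odot (a b : vec) : sym2 :=
  Sym2 (/ 2 * (fst a * fst b + fst a * fst b))
       (/ 2 * (fst a * snd b + snd a * fst b))
       (/ 2 * (snd a * snd b + snd a * snd b)).

Definition tsqr (a : vec) : sym2 := odot a a.

Definition disc (r : R) (p : vec) : Prop := fst p ^ 2 + snd p ^ 2 < r ^ 2.

(* Topological support: the closure of the nonvanishing set. The uniform
   structure on R * R is the one of the sup norm, which induces the usual
   topology. *)
Definition support (h : vec -> R) (p : vec) : Prop :=
  forall P : vec -> Prop, locally p P -> exists q : vec, P q /\ h q <> 0.

Definition compact_set {T : UniformSpace} (K : T -> Prop) : Prop :=
  forall (I : Type) (U : I -> T -> Prop),
    (forall i, open (U i)) ->
    (forall x, K x -> exists i, U i x) ->
    exists l : list I, forall x, K x -> exists i, In i l /\ U i x.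

Definition C2 (h : vec -> R) : Prop :=
  forall x y : R, ex_diff_n (fun a b => h (a, b)) 2 x y.

Definition C2c_fun (r : R) (h : vec -> R) : Prop :=
  C2 h /\ compact_set (support h) /\ (forall p, support h p -> disc r p).

Definition C2c (r : R) (f : vec -> sym2) : Prop :=
  C2c_fun r (fun p => c11 (f p)) /\
  C2c_fun r (fun p => c12 (f p)) /\
  C2c_fun r (fun p => c22 (f p)).

Definition Xray (a : vec) (h : vec -> R) (x : vec) : R :=
  RInt_gen (fun t => h (vadd x (vscal t a))) (at_point 0) (Rbar_locally p_infty).

Definition Vlong (u v : vec) (f : vec -> sym2) (x : vec) : R :=
  Xray u (fun p => inner (f p) (tsqr u)) x
  + Xray v (fun p => inner (f p) (tsqr v)) x.

Definition Vtrans (u v : vec) (f : vec -> sym2) (x : vec) : R :=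
  Xray u (fun p => inner (f p) (tsqr (perp u))) x
  + Xray v (fun p => inner (f p) (tsqr (perp v))) x.

Definition Vmixed (u v : vec) (f : vec -> sym2) (x : vec) : R :=
  Xray u (fun p => inner (f p) (odot u (perp u))) x
  + Xray v (fun p => inner (f p) (odot v (perp v))) x.

(* phi is (Frechet) differentiable on the whole plane with gradient G. *)
Definition is_gradient (phi : vec -> R) (G : vec -> vec) : Prop :=
  forall x y : R,
    differentiable_pt_lim (fun a b => phi (a, b)) x y
      (fst (G (x, y))) (snd (G (x, y))).

(* Main.v *)
Require Import Defs.
From Stdlib Require Import Reals Lra FunctionalExtensionality.
From Coquelicot Require Import Coquelicot.
Open Scope R_scope.

(** Write [D_a] for the derivative in direction [a].  In each of the three
    statements the two integrands have the form [A + k C] along [u = (u1, u2)]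
    and [A - k C] along [v = (-u1, u2)], where [k = u2 / u1] and [(A, C)] is the
    field that is to be a gradient.  So all three are instances of one theorem
    about continuous fields [(A, C)] that vanish outside a horizontal strip
    ([Vline_zero_iff_gradient], [Vline_gradient]).  The algebra behind it is
    that [D_u phi = u1 (A + k C)] and [D_v phi = - u1 (A - k C)] hold together
    exactly when [phi] has gradient [(A, C)].

    If [phi] exists, each ray integral is, by the fundamental theorem of
    calculus, [phi] far out on the ray minus [phi] at the vertex, up to the
    factor [1 / u1] or [- 1 / u1].  In the sum the vertex values cancel; the
    far values cancel too, because the far ends of the two rays are joined by a
    horizontal segment outside the strip, where [phi] does not vary.

    If the sum of the ray integrals vanishes, let [phi] be [- u1] times the
    integral along [u].  By hypothesis [phi] is also [u1] times the integral
    along [v].  Sliding the vertex of a ray along the ray differentiates its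
    integral, so [phi] has the required derivatives along [u] from the first
    expression and along [v] from the second.  These are continuous and [u],
    [v] are independent, so [phi] is Frechet differentiable with gradient
    [(A, C)] ([gradient_of_two_directions]).  Nothing has to be differentiated
    under the integral sign. *)

(** * Continuity and lines *)

Lemma continuous_of_2d (h : vec -> R) (p : vec) :
  continuity_2d_pt (fun a b => h (a, b)) (fst p) (snd p) -> continuous h p.
Proof.
destruct p as [x y]; simpl; intros H.
apply continuity_2d_pt_filterlim in H.
apply (filterlim_ext (fun z : R * R => h (fst z, snd z))); [|exact H].
now intros [a b].
Qed.

Lemma continuous_2d_affine (h : vec -> R) (a b : vec) (z : R * R) :
  (forall p, continuous h p) ->
  continuous (fun w : R * R =>
    h (vadd (vscal (snd w) b) (vscal (fst w) a))) z.
Proof.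
intros Hh.
assert (L : forall c d : R,
  continuous (fun w : R * R => snd w * c + fst w * d) z).
{ intros c d.
  apply (continuous_plus (fun w : R * R => snd w * c) (fun w => fst w * d)).
  - apply (continuous_mult (K := R_AbsRing) (fun w : R * R => snd w) (fun _ => c));
      [apply continuous_snd | apply continuous_const].
  - apply (continuous_mult (K := R_AbsRing) (fun w : R * R => fst w) (fun _ => d));
      [apply continuous_fst | apply continuous_const]. }
apply (continuous_comp_2 (fun w : R * R => snd w * fst b + fst w * fst a)
         (fun w : R * R => snd w * snd b + fst w * snd a)
         (fun x y => h (x, y))); [apply L | apply L | ].
eapply continuous_ext; [|apply Hh]. now intros [c d].
Qed.

Lemma continuous_along_line (h : vec -> R) (x a : vec) (t : R) :
  (forall p, continuous h p) ->
  continuous (fun s => h (vadd x (vscal s a))) t.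
Proof.
intros Hh.
apply (continuous_ext (fun s => h (vadd (vscal 1 x) (vscal s a)))).
{ intros s; f_equal; unfold vadd, vscal; simpl; f_equal; ring. }
apply (continuous_comp_2 (fun s : R => s) (fun _ : R => 1)
         (fun s r => h (vadd (vscal r x) (vscal s a)))).
- apply continuous_id.
- apply continuous_const.
- now apply (continuous_2d_affine h a x).
Qed.

Lemma vadd_shift (x a : vec) (s t : R) :
  vadd (vadd x (vscal s a)) (vscal t a) = vadd x (vscal (s + t) a).
Proof. unfold vadd, vscal; simpl; f_equal; ring. Qed.

Lemma ray_leaves_strip (r x a t : R) :
  a <> 0 -> (Rabs r + Rabs x) / Rabs a <= t -> r <= Rabs (x + t * a).
Proof.
intros Ha Ht.
assert (Pa := Rabs_pos_lt a Ha).
assert (H : Rabs r + Rabs x <= t * Rabs a).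
{ apply (Rmult_le_compat_r (Rabs a)) in Ht; [|lra].
  unfold Rdiv in Ht; rewrite Rmult_assoc, Rinv_l, Rmult_1_r in Ht; lra. }
assert (H0 : 0 <= (Rabs r + Rabs x) / Rabs a).
{ apply Rmult_le_pos; [|apply Rlt_le, Rinv_0_lt_compat, Pa].
  pose proof (Rabs_pos r); pose proof (Rabs_pos x); lra. }
assert (Et : t * Rabs a = Rabs (t * a)).
{ rewrite Rabs_mult, (Rabs_pos_eq t); lra. }
pose proof (Rabs_triang (x + t * a) (- x)) as T.
replace (x + t * a + - x) with (t * a) in T by ring.
rewrite Rabs_Ropp in T.
pose proof (Rle_abs r); lra.
Qed.

(** * Ray integrals *)

(** Past the point [T] the integrand vanishes and the primitive is constant, so
    the partial integrals are eventually equal to [P T - P 0].  A negative [T]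
    is harmless: then [P 0 = P T] and the integral is 0. *)
Lemma Xray_primitive (h : vec -> R) (a x : vec) (P : R -> R) (T : R) :
  (forall p, continuous h p) ->
  (forall t, is_derive P t (h (vadd x (vscal t a)))) ->
  (forall t, T <= t -> h (vadd x (vscal t a)) = 0) ->
  Xray a h x = P T - P 0.
Proof.
intros Hh HP HT.
assert (Pconst : forall t, T <= t -> P t = P T).
{ intros t [Ht|<-]; [|reflexivity].
  symmetry; apply (eq_is_derive P T t); [|exact Ht].
  intros s [Hs _]; evar_last; [apply HP | exact (HT s Hs)]. }
apply is_RInt_gen_unique.
intros Q HQ; unfold filtermapi.
apply (Filter_prod _ _ _ (fun s => s = 0) (fun t => T < t)).
- reflexivity.
- now exists T.
- intros s t -> Ht; exists (P T - P 0); split; [|now apply locally_singleton].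
  rewrite <- (Pconst t) by lra.
  apply (is_RInt_derive P (fun t => h (vadd x (vscal t a)))); intros r _.
  + apply HP.
  + now apply continuous_along_line.
Qed.

(** Sliding the vertex along the ray removes the part slid over from the domain
    of integration; hence the minus sign. *)
Lemma is_derive_Xray (h : vec -> R) (a x : vec) (M s : R) :
  (forall p, continuous h p) ->
  (forall t, M <= t -> h (vadd x (vscal t a)) = 0) ->
  is_derive (fun t => Xray a h (vadd x (vscal t a))) s
    (- h (vadd x (vscal s a))).
Proof.
intros Hh HM.
set (g := fun t => h (vadd x (vscal t a))).
set (P := fun t => RInt g 0 t).
assert (HP : forall t, is_derive P t (g t)).
{ intros t; apply (is_derive_RInt g P 0); [|now apply continuous_along_line].
  apply filter_forall; intros b; apply (RInt_correct g).
  apply ex_RInt_continuous; intros z _; now apply continuous_along_line. }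
apply (is_derive_ext (fun t => P M - P t)).
- intros t.
  rewrite (Xray_primitive h a _ (fun r => P (t + r)) (M - t)); auto.
  + replace (t + (M - t)) with M by (simpl; ring); now rewrite Rplus_0_r.
  + intros r; rewrite vadd_shift.
    evar_last; [apply (is_derive_comp P (fun r => t + r));
      [apply HP | auto_derive; [exact I | reflexivity]] | ].
    unfold scal; simpl; unfold mult; simpl; apply Rmult_1_l.
  + intros r Hr; rewrite vadd_shift; apply HM; lra.
- evar_last; [apply (is_derive_minus (fun _ => P M) P);
    [apply is_derive_const | apply HP] | ].
  unfold minus, plus, opp, zero; simpl; apply Rplus_0_l.
Qed.

(** * Gradients and directional derivatives *)

Lemma differentiable_pt_lim_linear (m n x y : R) :
  differentiable_pt_lim (fun a b => m * a + n * b) x y m n.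
Proof.
intros eps; exists (mkposreal 1 Rlt_0_1); intros a b _ _.
match goal with |- Rabs ?e <= _ => replace e with 0 by ring end.
rewrite Rabs_R0; apply Rmult_le_pos; [apply Rlt_le, cond_pos|].
eapply Rle_trans; [apply Rabs_pos | apply Rmax_l].
Qed.

Lemma is_derive_along_line (phi : vec -> R) (G : vec -> vec) (x a : vec) (t : R) :
  is_gradient phi G ->
  is_derive (fun s => phi (vadd x (vscal s a))) t
    (fst (G (vadd x (vscal t a))) * fst a + snd (G (vadd x (vscal t a))) * snd a).
Proof.
intros HG.
apply is_derive_Reals.
apply (derivable_pt_lim_comp_2d (fun b c => phi (b, c))
         (fun s => fst x + s * fst a) (fun s => snd x + s * snd a)).
- apply HG.
- apply is_derive_Reals; auto_derive; [exact I | ring].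
- apply is_derive_Reals; auto_derive; [exact I | ring].
Qed.

(** In the coordinates of the basis [(a, b)] the directional derivatives are
    partial derivatives, and a function with continuous partial derivatives is
    Frechet differentiable; the change back to standard coordinates is
    Cramer's rule. *)
Lemma gradient_of_two_directions (phi : vec -> R) (G : vec -> vec) (a b : vec) :
  fst a * snd b - snd a * fst b <> 0 ->
  (forall p, continuous (fun q => fst (G q) * fst a + snd (G q) * snd a) p) ->
  (forall x t, is_derive (fun s => phi (vadd x (vscal s a))) t
    (fst (G (vadd x (vscal t a))) * fst a + snd (G (vadd x (vscal t a))) * snd a)) ->
  (forall x t, is_derive (fun s => phi (vadd x (vscal s b))) t
    (fst (G (vadd x (vscal t b))) * fst b + snd (G (vadd x (vscal t b))) * snd b)) ->
  is_gradient phi G.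
Proof.
intros Hd Hc Da Db x y.
set (d := fst a * snd b - snd a * fst b) in Hd.
set (psi := fun s t => phi (vadd (vscal t b) (vscal s a))).
set (S := fun x y => snd b / d * x + - fst b / d * y).
set (T := fun x y => - snd a / d * x + fst a / d * y).
assert (E : forall x y, vadd (vscal (T x y) b) (vscal (S x y) a) = (x, y)).
{ intros x' y'; unfold S, T, vadd, vscal; simpl; f_equal; unfold d; field; exact Hd. }
apply (differentiable_pt_lim_ext (fun x y => psi (S x y) (T x y))).
{ apply locally_2d_forall; intros x' y'; unfold psi; now rewrite E. }
assert (Dpsi : differentiable_pt_lim psi (S x y) (T x y)
  (fst (G (x, y)) * fst a + snd (G (x, y)) * snd a)
  (fst (G (x, y)) * fst b + snd (G (x, y)) * snd b)).
{ rewrite <- (E x y).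
  set (s := S x y); set (t := T x y).
  apply filterdiff_differentiable_pt_lim.
  apply (is_derive_filterdiff psi s t (fun s t =>
    fst (G (vadd (vscal t b) (vscal s a))) * fst a
    + snd (G (vadd (vscal t b) (vscal s a))) * snd a)).
  - apply filter_forall; intros [s' t']; apply Da.
  - apply (is_derive_ext (fun z => phi (vadd (vscal s a) (vscal z b)))).
    { intros z; unfold psi; f_equal; unfold vadd; f_equal; ring. }
    replace (vadd (vscal t b) (vscal s a)) with (vadd (vscal s a) (vscal t b))
      by (unfold vadd; f_equal; ring).
    apply Db.
  - apply (continuous_2d_affine (fun q => fst (G q) * fst a + snd (G q) * snd a) a b),
      Hc. }
pose proof (differentiable_pt_lim_comp psi S T x y _ _ _ _ _ _ Dpsi
  (differentiable_pt_lim_linear _ _ x y) (differentiable_pt_lim_linear _ _ x y))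
  as H.
match type of H with differentiable_pt_lim _ _ _ ?p ?q =>
  replace p with (fst (G (x, y))) in H by (unfold d; field; exact Hd);
  replace q with (snd (G (x, y))) in H by (unfold d; field; exact Hd)
end.
exact H.
Qed.

(** * V-line transforms that vanish *)

(** Both directions have vertical component [u2], so at equal parameters the two
    rays are at the same height; that is why vanishing outside a horizontal strip
    is the natural hypothesis on the field. *)
Lemma Vline_zero_iff_gradient (r u1 u2 : R) (A C : vec -> R) :
  u1 <> 0 -> u2 <> 0 ->
  (forall p, continuous A p) -> (forall p, continuous C p) ->
  (forall p, r <= Rabs (snd p) -> A p = 0) ->
  (forall p, r <= Rabs (snd p) -> C p = 0) ->
  ((forall x,
      Xray (u1, u2) (fun p => A p + u2 / u1 * C p) x
      + Xray (- u1, u2) (fun p => A p - u2 / u1 * C p) x = 0) <->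
   exists phi, is_gradient phi (fun p => (A p, C p))).
Proof.
intros Hu1 Hu2 cA cC zA zC.
set (hu := fun p => A p + u2 / u1 * C p).
set (hv := fun p => A p - u2 / u1 * C p).
assert (cC' : forall c p, continuous (fun q => c * C q) p).
{ intros c p; apply (continuous_mult (K := R_AbsRing) (fun _ => c) C);
    [apply continuous_const | apply cC]. }
assert (cA' : forall c p, continuous (fun q => c * A q) p).
{ intros c p; apply (continuous_mult (K := R_AbsRing) (fun _ => c) A);
    [apply continuous_const | apply cA]. }
assert (chu : forall p, continuous hu p).
{ intros p; apply (continuous_plus A (fun q => u2 / u1 * C q)); auto. }
assert (chv : forall p, continuous hv p).
{ intros p; apply (continuous_minus A (fun q => u2 / u1 * C q)); auto. }
assert (zhu : forall p, r <= Rabs (snd p) -> hu p = 0).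
{ intros p Hp; unfold hu; rewrite zA, zC by exact Hp; ring. }
assert (zhv : forall p, r <= Rabs (snd p) -> hv p = 0).
{ intros p Hp; unfold hv; rewrite zA, zC by exact Hp; ring. }
set (M := fun x : vec => (Rabs r + Rabs (snd x)) / Rabs u2).
assert (out : forall (x : vec) t, M x <= t -> r <= Rabs (snd x + t * u2)).
{ intros x t; now apply ray_leaves_strip. }
split.
- intros H.
  exists (fun x => - u1 * Xray (u1, u2) hu x).
  apply (gradient_of_two_directions _ _ (u1, u2) (- u1, u2)); simpl.
  + replace (u1 * u2 - u2 * - u1) with (2 * (u1 * u2)) by ring.
    apply Rmult_integral_contrapositive_currified; [lra|].
    now apply Rmult_integral_contrapositive_currified.
  + intros p; apply (continuous_ext (fun q => u1 * A q + u2 * C q)).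
    { intros q; simpl; ring. }
    apply (continuous_plus (fun q => u1 * A q) (fun q => u2 * C q)); auto.
  + intros x t; evar_last.
    * apply is_derive_scal, (is_derive_Xray hu (u1, u2) x (M x)); auto.
      intros s Hs; apply zhu, out, Hs.
    * unfold scal, hu; simpl; unfold mult; simpl; field; exact Hu1.
  + intros x t.
    apply (is_derive_ext
      (fun s => u1 * Xray (- u1, u2) hv (vadd x (vscal s (- u1, u2))))).
    { intros s; specialize (H (vadd x (vscal s (- u1, u2)))).
      replace (Xray (- u1, u2) hv (vadd x (vscal s (- u1, u2))))
        with (- Xray (u1, u2) hu (vadd x (vscal s (- u1, u2)))) by lra.
      simpl; ring. }
    evar_last.
    * apply is_derive_scal, (is_derive_Xray hv (- u1, u2) x (M x)); auto.
      intros s Hs; apply zhv, out, Hs.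
    * unfold scal, hv; simpl; unfold mult; simpl; field; exact Hu1.
- intros [phi Hphi] x.
  rewrite (Xray_primitive hu (u1, u2) x
    (fun t => / u1 * phi (vadd x (vscal t (u1, u2)))) (M x)); auto.
  2:{ intros t; evar_last; [apply is_derive_scal,
      (is_derive_along_line phi (fun p => (A p, C p)) x), Hphi | ].
      unfold scal, hu; simpl; unfold mult; simpl; field; exact Hu1. }
  2:{ intros s Hs; apply zhu, out, Hs. }
  rewrite (Xray_primitive hv (- u1, u2) x
    (fun t => - / u1 * phi (vadd x (vscal t (- u1, u2)))) (M x)); auto.
  2:{ intros t; evar_last; [apply is_derive_scal,
      (is_derive_along_line phi (fun p => (A p, C p)) x), Hphi | ].
      unfold scal, hv; simpl; unfold mult; simpl; field; exact Hu1. }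
  2:{ intros s Hs; apply zhv, out, Hs. }
  replace (vadd x (vscal 0 (- u1, u2))) with (vadd x (vscal 0 (u1, u2)))
    by (unfold vadd, vscal; simpl; f_equal; ring).
  assert (E : phi (vadd x (vscal (M x) (- u1, u2)))
              = phi (vadd x (vscal (M x) (u1, u2)))).
  { set (far := vadd x (vscal (M x) (u1, u2))).
    assert (D : forall t,
      is_derive (fun s => phi (vadd far (vscal s (- u1, 0)))) t 0).
    { intros t; evar_last; [apply (is_derive_along_line phi (fun p => (A p, C p)) far),
        Hphi | ].
      simpl; rewrite zA; [ring | ].
      replace (snd (vadd far (vscal t (- u1, 0)))) with (snd x + M x * u2)
        by (unfold far, vadd, vscal; simpl; ring).
      now apply out, Rle_refl. }
    assert (K : forall s t, s < t ->
      phi (vadd far (vscal s (- u1, 0))) = phi (vadd far (vscal t (- u1, 0)))).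
    { intros s t Hst.
      apply (eq_is_derive (fun s => phi (vadd far (vscal s (- u1, 0)))) s t);
        [intros z _; apply D | exact Hst]. }
    (* [far] itself is parameter 0, the other end is parameter [2 * M x] *)
    assert (E0 : vadd far (vscal 0 (- u1, 0)) = far).
    { unfold far, vadd, vscal; simpl; f_equal; ring. }
    assert (E1 : vadd far (vscal (2 * M x) (- u1, 0))
                 = vadd x (vscal (M x) (- u1, u2))).
    { unfold far, vadd, vscal; simpl; f_equal; ring. }
    transitivity (phi (vadd far (vscal 0 (- u1, 0))));
      [rewrite <- E1 | now rewrite E0].
    destruct (Rtotal_order 0 (2 * M x)) as [h|[<-|h]].
    - symmetry; apply K, h.
    - reflexivity.
    - apply K, h. }
  rewrite E; ring.
Qed.

(** The form in which the tensor transforms meet the theorem: their integrands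
    are contractions of the tensor field, equal to [A + k C] and [A - k C] only
    after a computation. *)
Lemma Vline_gradient (r u1 u2 : R) (A C hu hv : vec -> R) (G : vec -> vec) :
  u1 <> 0 -> u2 <> 0 ->
  (forall p, continuous A p) -> (forall p, continuous C p) ->
  (forall p, r <= Rabs (snd p) -> A p = 0) ->
  (forall p, r <= Rabs (snd p) -> C p = 0) ->
  (forall p, hu p = A p + u2 / u1 * C p) ->
  (forall p, hv p = A p - u2 / u1 * C p) ->
  (forall p, G p = (A p, C p)) ->
  ((forall x, Xray (u1, u2) hu x + Xray (- u1, u2) hv x = 0) <->
   exists phi, is_gradient phi G).
Proof.
intros Hu1 Hu2 cA cC zA zC Eu Ev EG.
apply functional_extensionality in Eu; apply functional_extensionality in Ev.
apply functional_extensionality in EG; subst hu hv G.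
now apply (Vline_zero_iff_gradient r).
Qed.

(** * Tensor fields supported in a disc *)

Lemma C2c_continuous (r : R) (h : vec -> R) :
  C2c_fun r h -> forall p, continuous h p.
Proof.
intros [H _] p; apply continuous_of_2d; apply (H (fst p) (snd p)).
Qed.

Lemma C2c_zero (r : R) (h : vec -> R) :
  0 < r -> C2c_fun r h -> forall p, r <= Rabs (snd p) -> h p = 0.
Proof.
intros Hr [_ [_ H]] p Hp.
destruct (Req_dec (h p) 0) as [E|E]; [exact E|exfalso].
assert (D : Defs.disc r p).
{ apply H; intros P HP; exists p; split; [now apply locally_singleton | exact E]. }
unfold Defs.disc in D.
assert (r ^ 2 <= snd p ^ 2).
{ rewrite <- (pow2_abs (snd p)); apply pow_incr; lra. }
pose proof (pow2_ge_0 (fst p)); lra.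
Qed.

Theorem theorem3 (r1 : R) (hr1 : 0 < r1) (u1 u2 : R)
    (hu : unit_vec (u1, u2)) (huv : lin_indep (u1, u2) (- u1, u2))
    (f : vec -> sym2) (hf : C2c r1 f) :
  ((forall x : vec, Vlong (u1, u2) (- u1, u2) f x = 0) <->
   exists phi : vec -> R, is_gradient phi (fun p =>
     (u1 ^ 2 * c11 (f p) + u2 ^ 2 * c22 (f p), 2 * u1 ^ 2 * c12 (f p))))
  /\
  ((forall x : vec, Vtrans (u1, u2) (- u1, u2) f x = 0) <->
   exists phi : vec -> R, is_gradient phi (fun p =>
     (u2 ^ 2 * c11 (f p) + u1 ^ 2 * c22 (f p), - 2 * u1 ^ 2 * c12 (f p))))
  /\
  ((forall x : vec, Vmixed (u1, u2) (- u1, u2) f x = 0) <->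
   exists phi : vec -> R, is_gradient phi (fun p =>
     ((u1 ^ 2 - u2 ^ 2) * c12 (f p), - u1 ^ 2 * (c11 (f p) - c22 (f p))))).
Proof.
assert (Hu1 : u1 <> 0).
{ intros ->; destruct (huv 1 (-1)) as [K _];
  [unfold vadd, vscal; simpl; f_equal; ring | lra]. }
assert (Hu2 : u2 <> 0).
{ intros ->; destruct (huv 1 1) as [K _];
  [unfold vadd, vscal; simpl; f_equal; ring | lra]. }
destruct hf as [f11 [f12 f22]].
assert (c1 := C2c_continuous _ _ f11); assert (z1 := C2c_zero _ _ hr1 f11).
assert (c2 := C2c_continuous _ _ f12); assert (z2 := C2c_zero _ _ hr1 f12).
assert (c3 := C2c_continuous _ _ f22); assert (z3 := C2c_zero _ _ hr1 f22).
simpl in z1, z2, z3.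
assert (comb : forall (c d : R) (g h : vec -> R),
  (forall p, continuous g p) -> (forall p, continuous h p) ->
  forall p, continuous (fun q => c * g q + d * h q) p).
{ intros c d g h cg ch p.
  apply (continuous_plus (fun q => c * g q) (fun q => d * h q));
    now apply (continuous_scal_r (K := R_AbsRing) (V := R_NormedModule)). }
split; [|split].
- apply (Vline_gradient r1 u1 u2
    (fun p => u1 ^ 2 * c11 (f p) + u2 ^ 2 * c22 (f p))
    (fun p => 2 * u1 ^ 2 * c12 (f p))); auto; intros p.
  + now apply (continuous_scal_r (K := R_AbsRing) (V := R_NormedModule)).
  + intros Hp; rewrite z1, z3 by exact Hp; ring.
  + intros Hp; rewrite z2 by exact Hp; ring.
  + unfold inner; simpl; field; exact Hu1.
  + unfold inner; simpl; field; exact Hu1.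
- apply (Vline_gradient r1 u1 u2
    (fun p => u2 ^ 2 * c11 (f p) + u1 ^ 2 * c22 (f p))
    (fun p => - 2 * u1 ^ 2 * c12 (f p))); auto; intros p.
  + now apply (continuous_scal_r (K := R_AbsRing) (V := R_NormedModule)).
  + intros Hp; rewrite z1, z3 by exact Hp; ring.
  + intros Hp; rewrite z2 by exact Hp; ring.
  + unfold inner; simpl; field; exact Hu1.
  + unfold inner; simpl; field; exact Hu1.
- apply (Vline_gradient r1 u1 u2
    (fun p => (u1 ^ 2 - u2 ^ 2) * c12 (f p))
    (fun p => - u1 ^ 2 * (c11 (f p) - c22 (f p)))); auto; intros p.
  + now apply (continuous_scal_r (K := R_AbsRing) (V := R_NormedModule)).
  + apply (continuous_ext (fun q => - u1 ^ 2 * c11 (f q) + u1 ^ 2 * c22 (f q)));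
      [intros q; simpl; ring | auto].
  + intros Hp; rewrite z2 by exact Hp; ring.
  + intros Hp; rewrite z1, z3 by exact Hp; ring.
  + unfold inner; simpl; field; exact Hu1.
  + unfold inner; simpl; field; exact Hu1.
Qed.
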